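(* Let $\beta\equiv\beta^{(4)}$ be a nc sequence with moment matrix $\mathcal M_2$ of rank 5 or 6, and let $L_\beta$ be the Riesz functional of $\beta$. If $\beta$ admits a nc measure, then there exists an affine linear transformation $\phi$ such that the sequence $\widehat\beta$ given by $\widehat\beta_w=L_\beta(w\circ\phi)$ for every $|w|\le4$ has a moment matrix $\widehat{\mathcal M}_2$ with the following property. (1) If $\mathcal M_2$ is of rank 5, then $\widehat{\mathcal M}_2$ satisfies $\mathbb X\mathbb Y+\mathbb Y\mathbb X=\mathbf 0$ and one of the relations: $\mathbb X^2+\mathbb Y^2=\mathbf 1$; $\mathbb Y^2=\mathbf 1$; $\mathbb Y^2-\mathbb X^2=\mathbf 1$; $\mathbb Y^2=\mathbb X^2$. (2) If $\mathcal M_2$ is of rank 6, then $\widehat{\mathcal M}_2$ satisfies one of the relations: $\mathbb Y^2=\mathbf 1-\mathbb X^2$; $\mathbb Y^2=\mathbf 1+\mathbb X^2$; $\mathbb X\mathbb Y+\mathbb Y\mathbb X=\mathbf 0$; $\mathbb Y^2=\mathbf 1$.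
   Context: Words are elements of the free monoid on noncommuting letters $X,Y$; $|w|$ is the length of $w$, $w^*$ its reverse, and $v,w$ are cyclically equivalent if $v$ is a cyclic permutation of $w$. A sequence $\beta\equiv\beta^{(4)}=(\beta_w)_{|w|\le4}$ is a family of real numbers with $\beta_v=\beta_w$ for cyclically equivalent $v,w$ and $\beta_w=\beta_{w^*}$. It is a nc sequence if $\beta_{X^2Y^2}\ne\beta_{XYXY}$. Its moment matrix $\mathcal M_2$ is the symmetric $7\times7$ matrix with rows and columns indexed by $1,X,Y,X^2,XY,YX,Y^2$ and $(U,V)$ entry $\beta_{U^*V}$; the column indexed by $w$ is denoted $w(\mathbb X,\mathbb Y)$, $\mathbf 1$ is the column indexed by the empty word, and ''satisfies a relation'' means that the corresponding linear relation between columns holds. The sequence may be assumed normalized, $\beta_1=1$. The Riesz functional is the linear functional on noncommutative polynomials of degree $\le4$ with $L_\beta(w)=\beta_w$. An affine linear transformation is a map $\phi(x,y)=(a+bx+cy,\,d+ex+fy)$ with real coefficients and $bf-ce\neq0$; $w\circ\phi$ is the noncommutative polynomial obtained by substituting $a+bX+cY$ for $X$ and $d+eX+fY$ for $Y$ in $w$. A representing measure for $\beta$ consists of finitely many pairs $(A_i,B_i)$ (atoms) of real symmetric $t_i\times t_i$ matrices ($t_i$ is the size) and numbers $\lambda_i>0$ with $\sum_i\lambda_i=1$ and $\beta_w=\sum_i\lambda_i\mathrm{Tr}(w(A_i,B_i))$ for all $|w|\le4$, where $\mathrm{Tr}(A)=\frac1t\mathrm{tr}(A)$ for $A\in\mathbb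 R^{t\times t}$. It is of type $(m_1,\dots,m_r)$ if it has exactly $m_i$ atoms of size $i$ and $m_r\neq0$. It is minimal if no other representing measure has smaller type, where types are compared first by $r$, then by $m_r$, then $m_{r-1}$, ..., then $m_1$. $\beta$ admits a nc measure if it has a minimal representing measure of type $(m_1,\dots,m_r)$ with $r>1$. *)

(* Defs.v *)
From HB Require Import structures.
From mathcomp Require Import all_boot all_order all_algebra.
From mathcomp Require Import reals.
From mathcomp Require Import monalg.

Set Implicit Arguments.
Unset Strict Implicit.
Unset Printing Implicit Defensive.

Import Order.TTheory GRing.Theory Num.Theory.
Local Open Scope ring_scope.

(* The two letters are the booleans: [false] is X and [true] is Y. *)
Definition letterX : bool := false.
Definition letterY : bool := true.

Notation word := {fmonom bool} (only parsing).

Definition w1  : word := FMonom [::].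
Definition wX  : word := FMonom [:: letterX].
Definition wY  : word := FMonom [:: letterY].
Definition wXX : word := FMonom [:: letterX; letterX].
Definition wXY : word := FMonom [:: letterX; letterY].
Definition wYX : word := FMonom [:: letterY; letterX].
Definition wYY : word := FMonom [:: letterY; letterY].
Definition wXXYY : word := FMonom [:: letterX; letterX; letterY; letterY].
Definition wXYXY : word := FMonom [:: letterX; letterY; letterX; letterY].

Definition wlen (w : word) : nat := size w.
Definition wrev (w : word) : word := FMonom (rev w).
Definition wcat (v w : word) : word := FMonom (v ++ w).
Definition cyc_equiv (v w : word) : Prop :=
  exists k : nat, (w : seq bool) = rot k v.

Definition weval (S : pzRingType) (x y : S) (w : word) : S :=
  \prod_(l <- w) (if l == letterX then x else y).

Definition ncpoly (R : realType) := {malg R[word]}.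

(* A sequence is represented by a total function on words; its values at words
   of length > 4 are irrelevant: nothing below constrains them, and neither the
   moment matrix, nor the Riesz functional on polynomials of degree <= 4, nor
   the notion of representing measure depends on them. *)
Definition is_sequence (R : realType) (beta : word -> R) : Prop :=
  (forall v w : word, (wlen v <= 4)%N -> (wlen w <= 4)%N ->
     cyc_equiv v w -> beta v = beta w) /\
  (forall w : word, (wlen w <= 4)%N -> beta w = beta (wrev w)).

Definition is_nc_sequence (R : realType) (beta : word -> R) : Prop :=
  is_sequence beta /\ beta wXXYY <> beta wXYXY.

Definition index_words : 7.-tuple word :=
  [tuple w1; wX; wY; wXX; wXY; wYX; wYY].

Definition moment_matrix (R : realType) (beta : word -> R) : 'M[R]_7 :=
  \matrix_(i, j) beta (wcat (wrev (tnth index_words i)) (tnth index_words j)).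

(* Meaningful only for w among [index_words]. *)
Definition mcol (R : realType) (beta : word -> R) (w : word) : 'cV[R]_7 :=
  col (inord (index w index_words)) (moment_matrix beta).

(* L_beta(p) = \sum_w p_w beta_w, the sum being over the support of p. *)
Definition riesz (R : realType) (beta : word -> R) (p : ncpoly R) : R :=
  mmap idfun beta p.

Record affine_map (R : realType) := AffineMap {
  aff_a : R; aff_b : R; aff_c : R;
  aff_d : R; aff_e : R; aff_f : R;
  aff_nondeg : aff_b * aff_f - aff_c * aff_e != 0
}.

Definition affX (R : realType) (phi : affine_map R) : ncpoly R :=
  << aff_a phi *g w1 >> + << aff_b phi *g wX >> + << aff_c phi *g wY >>.
Definition affY (R : realType) (phi : affine_map R) : ncpoly R :=
  << aff_d phi *g w1 >> + << aff_e phi *g wX >> + << aff_f phi *g wY >>.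

Definition wcomp (R : realType) (w : word) (phi : affine_map R) : ncpoly R :=
  weval (affX phi) (affY phi) w.

Definition transform (R : realType) (phi : affine_map R) (beta : word -> R) :
  word -> R := fun w => riesz beta (wcomp w phi).

Record measure (R : realType) := Measure {
  natoms : nat;
  asize  : 'I_natoms -> nat;
  atomX  : forall i : 'I_natoms, 'M[R]_(asize i);
  atomY  : forall i : 'I_natoms, 'M[R]_(asize i);
  weight : 'I_natoms -> R
}.

Definition ntrace (R : realType) (t : nat) (A : 'M[R]_t) : R := \tr A / t%:R.

Definition represents (R : realType) (mu : measure R) (beta : word -> R) : Prop :=
  [/\ forall i : 'I_(natoms mu),
        [/\ (0 < asize i)%N, (atomX i)^T = atomX i, (atomY i)^T = atomY i
          & 0 < weight i],
      \sum_i weight (m := mu) i = 1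
    & forall w : word, (wlen w <= 4)%N ->
        beta w = \sum_(i < natoms mu)
                   weight i * ntrace (weval (atomX i) (atomY i) w)].

(* A type (m_1, ..., m_r) is the sequence [:: m_1; ...; m_r]. *)
Definition has_type (R : realType) (mu : measure R) (m : seq nat) : Prop :=
  last 0%N m <> 0%N /\
  forall i : nat,
    #|[pred j : 'I_(natoms mu) | asize j == i.+1]| = nth 0%N m i.

(* First by length, then lexicographically from the last entry down. *)
Definition type_lt (m n : seq nat) : bool :=
  (size m < size n)%N ||
  ((size m == size n) && ((rev m : seqlexi nat) < rev n)%O).

Definition minimal_of_type (R : realType) (beta : word -> R) (mu : measure R)
    (m : seq nat) : Prop :=
  [/\ represents mu beta, has_type mu m
    & forall (nu : measure R) (n : seq nat),
        represents nu beta -> has_type nu n -> ~~ type_lt n m].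

Definition admits_nc_measure (R : realType) (beta : word -> R) : Prop :=
  exists (mu : measure R) (m : seq nat),
    minimal_of_type beta mu m /\ (1 < size m)%N.

(* Main.v *)
From mathcomp Require Import all_boot all_order all_algebra.
From mathcomp Require Import reals.
From mathcomp Require Import monalg ring lra.
Require Import Defs.

Set Implicit Arguments.
Unset Strict Implicit.
Unset Printing Implicit Defensive.

Import Order.TTheory GRing.Theory Num.Theory.
Local Open Scope ring_scope.

(** A kernel vector of the moment matrix is a polynomial of degree at most 2
    vanishing at every atom, because L(p^* p) is a positive combination of the
    traces of p(A,B)^T p(A,B).  Since beta_{X^2Y^2} <> beta_{XYXY}, some atom
    (A,B) does not commute, which forces these polynomials to be symmetric under
    reversal and to have a nonzero quadratic part.  They are thus real conics
    in noncommuting variables, and affine changes of coordinates bring them to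
    normal form; traces at (A,B) exclude the degenerate and the empty conics.

    In rank 5 there is a pencil of conics.  It contains an indefinite form,
    which can be moved to XY + YX = k.  Then A^2 commutes with B and B^2 with A,
    so any other member u X^2 + w Y^2 + (linear) + c has no linear part, by
    taking commutators at (A,B).  If k <> 0, eliminating the constants between
    the two relations gives a homogeneous one, again indefinite, which is moved
    to XY + YX = 0; it remains to rescale the other relation. *)

(* [qXY] is the coefficient of XY + YX. *)
Record quad (R : realType) :=
  Quad { q1 : R; qX : R; qY : R; qXX : R; qXY : R; qYY : R }.

(** * Symmetric quadratic polynomials under affine changes of coordinates *)

Section Quadratics.
Variable R : realType.
Implicit Types (p q : quad R) (phi psi : affine_map R) (V : quad R -> Prop).

Definition qlin (s : R) p (t : R) q : quad R :=
  Quad (s * q1 p + t * q1 q) (s * qX p + t * qX q) (s * qY p + t * qY q)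
    (s * qXX p + t * qXX q) (s * qXY p + t * qXY q) (s * qYY p + t * qYY q).

Definition qscale (s : R) p : quad R :=
  Quad (s * q1 p) (s * qX p) (s * qY p) (s * qXX p) (s * qXY p) (s * qYY p).

Definition qzero : quad R := Quad 0 0 0 0 0 0.

Definition qsub q phi : quad R :=
  let: Quad k l m u v w := q in
  let: AffineMap a b c d e f _ := phi in
  Quad (k + l * a + m * d + u * a ^+ 2 + v * (a * d) *+ 2 + w * d ^+ 2)
    (l * b + m * e + u * (a * b) *+ 2 + v * (a * e + b * d) *+ 2
       + w * (d * e) *+ 2)
    (l * c + m * f + u * (a * c) *+ 2 + v * (a * f + c * d) *+ 2
       + w * (d * f) *+ 2)
    (u * b ^+ 2 + v * (b * e) *+ 2 + w * e ^+ 2)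
    (u * (b * c) + v * (b * f + c * e) + w * (e * f))
    (u * c ^+ 2 + v * (c * f) *+ 2 + w * f ^+ 2).

Definition qeval t (A B : 'M[R]_t) q : 'M[R]_t :=
  q1 q *: 1%:M + qX q *: A + qY q *: B + qXX q *: (A *m A)
    + qXY q *: (A *m B + B *m A) + qYY q *: (B *m B).

Definition actX t phi (A B : 'M[R]_t) : 'M[R]_t :=
  aff_a phi *: 1%:M + aff_b phi *: A + aff_c phi *: B.
Definition actY t phi (A B : 'M[R]_t) : 'M[R]_t :=
  aff_d phi *: 1%:M + aff_e phi *: A + aff_f phi *: B.

Lemma mulmx_affine t (A B : 'M[R]_t) (a b c d e f : R) :
  (a *: 1%:M + b *: A + c *: B) *m (d *: 1%:M + e *: A + f *: B) =
  (a * d) *: 1%:M + (a * e + b * d) *: A + (a * f + c * d) *: B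
  + (b * e) *: (A *m A) + (b * f) *: (A *m B) + (c * e) *: (B *m A)
  + (c * f) *: (B *m B).
Proof.
rewrite !mulmxDl !mulmxDr -!scalemxAl -!scalemxAr !mulmx1 !mul1mx.
move: (A *m A) (A *m B) (B *m A) (B *m B) 1%:M => AA AB BA BB I.
by apply/matrixP=> i j; rewrite !mxE; ring.
Qed.

Lemma qeval_sub t (A B : 'M[R]_t) q phi :
  qeval (actX phi A B) (actY phi A B) q = qeval A B (qsub q phi).
Proof.
case: q phi => k l m u v w [a b c d e f nd].
rewrite /qeval /actX /actY /= !mulmx_affine.
move: (A *m A) (A *m B) (B *m A) (B *m B) 1%:M => AA AB BA BB I.
by apply/matrixP=> i j; rewrite !mxE; ring.
Qed.

Lemma qeval_lin t (A B : 'M[R]_t) s p r q :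
  qeval A B (qlin s p r q) = s *: qeval A B p + r *: qeval A B q.
Proof.
rewrite /qeval /=.
move: (A *m A) (A *m B) (B *m A) (B *m B) 1%:M => AA AB BA BB I.
by apply/matrixP=> i j; rewrite !mxE; ring.
Qed.

Definition aff_det phi := aff_b phi * aff_f phi - aff_c phi * aff_e phi.

Lemma inv_nondeg phi :
  aff_f phi / aff_det phi * (aff_b phi / aff_det phi)
  - - aff_c phi / aff_det phi * (- aff_e phi / aff_det phi) != 0.
Proof.
have nd := aff_nondeg phi; rewrite -/(aff_det phi) in nd.
suff -> : aff_f phi / aff_det phi * (aff_b phi / aff_det phi)
  - - aff_c phi / aff_det phi * (- aff_e phi / aff_det phi) = (aff_det phi)^-1.
  by rewrite invr_eq0.
by rewrite /aff_det in nd *; field.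
Qed.

Definition aff_inv phi : affine_map R :=
  @AffineMap R
    ((aff_c phi * aff_d phi - aff_f phi * aff_a phi) / aff_det phi)
    (aff_f phi / aff_det phi) (- aff_c phi / aff_det phi)
    ((aff_e phi * aff_a phi - aff_b phi * aff_d phi) / aff_det phi)
    (- aff_e phi / aff_det phi) (aff_b phi / aff_det phi) (inv_nondeg phi).

Lemma comp_nondeg phi psi :
  (aff_b phi * aff_b psi + aff_c phi * aff_e psi) *
  (aff_e phi * aff_c psi + aff_f phi * aff_f psi) -
  (aff_b phi * aff_c psi + aff_c phi * aff_f psi) *
  (aff_e phi * aff_b psi + aff_f phi * aff_e psi) != 0.
Proof.
have -> : (aff_b phi * aff_b psi + aff_c phi * aff_e psi) *
  (aff_e phi * aff_c psi + aff_f phi * aff_f psi) -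
  (aff_b phi * aff_c psi + aff_c phi * aff_f psi) *
  (aff_e phi * aff_b psi + aff_f phi * aff_e psi) = aff_det phi * aff_det psi.
  by rewrite /aff_det; ring.
by rewrite mulf_neq0 ?aff_nondeg.
Qed.

Definition aff_comp phi psi : affine_map R :=
  @AffineMap R
    (aff_a phi + aff_b phi * aff_a psi + aff_c phi * aff_d psi)
    (aff_b phi * aff_b psi + aff_c phi * aff_e psi)
    (aff_b phi * aff_c psi + aff_c phi * aff_f psi)
    (aff_d phi + aff_e phi * aff_a psi + aff_f phi * aff_d psi)
    (aff_e phi * aff_b psi + aff_f phi * aff_e psi)
    (aff_e phi * aff_c psi + aff_f phi * aff_f psi) (comp_nondeg phi psi).

Lemma qsub_comp q phi psi :
  qsub (qsub q phi) psi = qsub q (aff_comp phi psi).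
Proof.
case: q phi psi => k l m u v w [a b c d e f nd] [a' b' c' d' e' f' nd'].
by rewrite /=; congr Quad; ring.
Qed.

Lemma qsub_inv q phi : qsub (qsub q phi) (aff_inv phi) = q.
Proof.
case: q phi => k l m u v w [a b c d e f nd].
by rewrite /= /aff_det /=; congr Quad; field.
Qed.

Lemma qsub_invK q phi : qsub (qsub q (aff_inv phi)) phi = q.
Proof.
case: q phi => k l m u v w [a b c d e f nd].
by rewrite /= /aff_det /=; congr Quad; field.
Qed.

Lemma qsub_lin s p t q phi :
  qsub (qlin s p t q) phi = qlin s (qsub p phi) t (qsub q phi).
Proof.
case: p q phi => k l m u v w [k' l' m' u' v' w'] [a b c d e f nd].
by rewrite /qlin /=; congr Quad; ring.
Qed.

Lemma qsub_scale s p phi : qsub (qscale s p) phi = qscale s (qsub p phi).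
Proof.
case: p phi => k l m u v w [a b c d e f nd].
by rewrite /qscale /=; congr Quad; ring.
Qed.

Definition nc_pair t (A B : 'M[R]_t) :=
  [/\ A^T = A, B^T = B & A *m B - B *m A != 0].

(** An affine map multiplies the commutator by its determinant. *)
Lemma nc_pair_act t (A B : 'M[R]_t) phi :
  nc_pair A B -> nc_pair (actX phi A B) (actY phi A B).
Proof.
case=> sA sB nAB; split.
- by rewrite /actX !linearD !linearZ /= trmx1 sA sB.
- by rewrite /actY !linearD !linearZ /= trmx1 sA sB.
have -> : actX phi A B *m actY phi A B - actY phi A B *m actX phi A B
        = aff_det phi *: (A *m B - B *m A).
  rewrite /actX /actY !mulmx_affine /aff_det.
  move: (A *m A) (A *m B) (B *m A) (B *m B) 1%:M => AA AB BA BB I.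
  by apply/matrixP=> i j; rewrite !mxE; ring.
by rewrite scaler_eq0 negb_or nAB andbT aff_nondeg.
Qed.

(** [V] may omit some relations at (A, B): later it holds the relations common to all atoms, while
    (A, B) is one noncommuting atom. *)
Definition relspace V t (A B : 'M[R]_t) :=
  [/\ nc_pair A B,
      forall q, V q -> qeval A B q = 0
    & forall s p r q, V p -> V q -> V (qlin s p r q)].

(** By [qeval_sub], these are the relations of [V] rewritten in the coordinates given by [phi]. *)
Definition pull V phi : quad R -> Prop := fun q => V (qsub q phi).

Lemma relspace_pull V t (A B : 'M[R]_t) phi :
  relspace V A B -> relspace (pull V phi) (actX phi A B) (actY phi A B).
Proof.
case=> nAB ev li; split; first exact: nc_pair_act.
- by move=> q /ev; rewrite qeval_sub.
- by move=> s p r q Vp Vq; rewrite /pull qsub_lin; apply: li.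
Qed.

(** To simplify a relation by substituting [phi], the atoms move by the inverse of [phi]. *)
Lemma pull_inv V q phi : V q -> pull V (aff_inv phi) (qsub q phi).
Proof. by rewrite /pull qsub_inv. Qed.

Lemma relspace_scale V t (A B : 'M[R]_t) s q :
  relspace V A B -> V q -> V (qscale s q).
Proof.
case=> _ _ li Vq; have := li s q 0 q Vq Vq; congr V.
by rewrite /qlin /qscale; congr Quad; ring.
Qed.

Lemma mxtrace_gram m n (Z : 'M[R]_(m, n)) :
  \tr (Z^T *m Z) = \sum_i \sum_j Z j i ^+ 2.
Proof.
apply: eq_bigr => i _; rewrite mxE; apply: eq_bigr => j _.
by rewrite mxE expr2.
Qed.

Lemma mxtrace_gram_ge0 m n (Z : 'M[R]_(m, n)) : 0 <= \tr (Z^T *m Z).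
Proof.
rewrite mxtrace_gram; apply: sumr_ge0 => i _; apply: sumr_ge0 => j _.
exact: sqr_ge0.
Qed.

Lemma mxtrace_gram_eq0 m n (Z : 'M[R]_(m, n)) : \tr (Z^T *m Z) = 0 -> Z = 0.
Proof.
rewrite mxtrace_gram => Z0; apply/matrixP=> j i; rewrite [RHS]mxE.
have sq0 i' : 0 <= \sum_j Z j i' ^+ 2.
  by apply: sumr_ge0 => j' _; apply: sqr_ge0.
have /psumr_eq0P/(_ i isT) := Z0; move=> /(_ (fun i' _ => sq0 i')).
move/psumr_eq0P => /(_ (fun j' _ => sqr_ge0 _) j isT) /eqP.
by rewrite sqrf_eq0 => /eqP.
Qed.

Lemma mxtrace_sqr_gt0 n (Z : 'M[R]_n) : Z^T = Z -> Z != 0 -> 0 < \tr (Z *m Z).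
Proof.
move=> sZ nZ; have := mxtrace_gram_ge0 Z; have := @mxtrace_gram_eq0 _ _ Z.
rewrite sZ lt_def => H ->; rewrite andbT.
by apply: contraNneq nZ => /H ->.
Qed.

(** * What a relation at a noncommuting pair forces on its coefficients *)

Section Vanishing.
Variables (V : quad R -> Prop) (t : nat) (A B : 'M[R]_t).
Hypothesis rV : relspace V A B.

(** In the commutator with B the terms in 1, Y and Y^2 cancel, which leaves l(AB - BA) = 0. *)
Lemma relspace_X0 k l m w : V (Quad k l m 0 0 w) -> l = 0.
Proof.
case: rV => -[_ _ nAB] ev _ /ev H.
suff /eqP : l *: (A *m B - B *m A) = 0.
  by rewrite scaler_eq0 (negbTE nAB) orbF => /eqP.
have -> : l *: (A *m B - B *m A) = qeval A B (Quad k l m 0 0 w) *m B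
     - B *m qeval A B (Quad k l m 0 0 w).
  rewrite /qeval /= !mulmxDl !mulmxDr -!scalemxAl -!scalemxAr !mulmx1 !mul1mx.
  rewrite !mulmxA.
  move: (A *m B) (B *m A) (B *m B) (B *m B *m B) => AB BA BB BBB.
  rewrite !scale0r.
  by apply/matrixP=> i j; rewrite !mxE; ring.
by rewrite H mul0mx mulmx0 subr0.
Qed.

Lemma relspace_Y0 k l m u : V (Quad k l m u 0 0) -> m = 0.
Proof.
case: rV => -[_ _ nAB] ev _ /ev H.
suff /eqP : m *: (A *m B - B *m A) = 0.
  by rewrite scaler_eq0 (negbTE nAB) orbF => /eqP.
have -> : m *: (A *m B - B *m A) = A *m qeval A B (Quad k l m u 0 0)
     - qeval A B (Quad k l m u 0 0) *m A.
  rewrite /qeval /= !mulmxDl !mulmxDr -!scalemxAl -!scalemxAr !mulmx1 !mul1mx.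
  rewrite !mulmxA !scale0r.
  move: (A *m B) (B *m A) (A *m A) (A *m A *m A) => AB BA AA AAA.
  by apply/matrixP=> i j; rewrite !mxE; ring.
by rewrite H mul0mx mulmx0 subr0.
Qed.

Lemma relspace_dim_gt0 : (0 < t)%N.
Proof.
case: rV => -[_ _ nAB] _ _; move: A B nAB.
by case: t => // A' B'; rewrite [_ - _]flatmx0 eqxx.
Qed.

(** Commutators remove the linear part; the constant then multiplies the identity, which is nonzero,
    as otherwise A = 0 would commute with B. So a nonzero relation has a nonzero quadratic part. *)
Lemma relspace_linear0 k l m : V (Quad k l m 0 0 0) -> Quad k l m 0 0 0 = qzero.
Proof.
move=> H; have l0 := relspace_X0 H; have m0 := relspace_Y0 H; subst l m.
case: rV => -[_ _ nAB] ev _; move/ev: H.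
rewrite /qeval /= !scale0r !addr0 => /eqP; rewrite scaler_eq0.
case/orP => [/eqP -> //|/eqP I0]; move: nAB.
by rewrite -[A]mulmx1 I0 !mulmx0 !mul0mx subrr eqxx.
Qed.

(** The trace of the relation is k t + u tr(A^2) + w tr(B^2) = 0, and both traces are positive since
    A and B are symmetric and nonzero. *)
Lemma relspace_pos k u w : V (Quad k 0 0 u 0 w) ->
  0 <= u -> 0 <= w -> (u != 0) || (w != 0) -> k < 0.
Proof.
have t0 := relspace_dim_gt0.
case: rV => -[sA sB nAB] ev _ /ev /(congr1 (@mxtrace R t)) /eqP.
rewrite /qeval /= !scale0r !addr0 !mxtraceD !mxtraceZ mxtrace1 mxtrace0.
have A0 : A != 0 by apply: contraNneq nAB => ->; rewrite mul0mx mulmx0 subrr.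
have B0 : B != 0 by apply: contraNneq nAB => ->; rewrite mul0mx mulmx0 subrr.
have := mxtrace_sqr_gt0 sA A0; have := mxtrace_sqr_gt0 sB B0.
move: (\tr _) (\tr _) => x y x0 y0 /eqP H u0 w0 uw.
have t0' : 0 < t%:R :> R by rewrite ltr0n.
have S0 : 0 < u * x + w * y.
  case/orP: uw => [un|wn].
    by apply: ltr_pwDl; [rewrite mulr_gt0 // lt_def un|rewrite mulr_ge0 // ltW].
  by apply: ltr_wpDl; [rewrite mulr_ge0 // ltW|rewrite mulr_gt0 // lt_def wn].
have : k * t%:R < 0 by lra.
by rewrite pmulr_llt0.
Qed.

(* If AB + BA is scalar then A^2 commutes with B and B^2 with A, so only the
   linear part of a relation without XY + YX contributes to commutators. *)
Lemma relspace_anticomm k l m c u w :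
  V (Quad k 0 0 0 1 0) -> V (Quad c l m u 0 w) -> l = 0 /\ m = 0.
Proof.
case: rV => -[_ _ nAB] ev _ /ev H /ev H2.
have {H} : A *m B + B *m A = - k *: 1%:M.
  move: H; rewrite /qeval /= !scale0r !addr0 scale1r => /eqP.
  by rewrite addrC addr_eq0 => /eqP ->; rewrite scaleNr.
move=> anti.
have cA : A *m A *m B = B *m A *m A.
  have -> : A *m A *m B = A *m (A *m B + B *m A) - A *m B *m A.
    by rewrite mulmxDr !mulmxA addrK.
  have -> : A *m B *m A = (A *m B + B *m A) *m A - B *m A *m A.
    by rewrite mulmxDl addrK.
  by rewrite anti -scalemxAl -scalemxAr mulmx1 mul1mx opprB addrC subrK.
have cB : B *m B *m A = A *m B *m B.
  have -> : B *m B *m A = B *m (A *m B + B *m A) - B *m A *m B.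
    by rewrite mulmxDr !mulmxA addrC addKr.
  have -> : B *m A *m B = (A *m B + B *m A) *m B - A *m B *m B.
    by rewrite mulmxDl addrC addKr.
  by rewrite anti -scalemxAl -scalemxAr mulmx1 mul1mx opprB addrC subrK.
split; apply/eqP.
  suff /eqP : l *: (A *m B - B *m A) = 0.
    by rewrite scaler_eq0 (negbTE nAB) orbF.
  have -> : l *: (A *m B - B *m A) = qeval A B (Quad c l m u 0 w) *m B
     - B *m qeval A B (Quad c l m u 0 w).
    rewrite /qeval /= !scale0r !addr0.
    rewrite !mulmxDl !mulmxDr -!scalemxAl -!scalemxAr !mulmx1 !mul1mx.
    rewrite !mulmxA cA.
    move: (A *m B) (B *m A) (B *m B) (B *m B *m B) (B *m A *m A).
    move=> AB BA BB BBB BAA.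
    by apply/matrixP=> i j; rewrite !mxE; ring.
  by rewrite H2 mul0mx mulmx0 subr0.
suff /eqP : m *: (A *m B - B *m A) = 0.
  by rewrite scaler_eq0 (negbTE nAB) orbF.
have -> : m *: (A *m B - B *m A) = A *m qeval A B (Quad c l m u 0 w)
   - qeval A B (Quad c l m u 0 w) *m A.
  rewrite /qeval /= !scale0r !addr0.
  rewrite !mulmxDl !mulmxDr -!scalemxAl -!scalemxAr !mulmx1 !mul1mx.
  rewrite !mulmxA cB.
  move: (A *m B) (B *m A) (A *m A) (A *m A *m A) (A *m B *m B).
  move=> AB BA AA AAA ABB.
  by apply/matrixP=> i j; rewrite !mxE; ring.
by rewrite H2 mul0mx mulmx0 subr0.
Qed.

End Vanishing.
End Quadratics.

(** * Normal forms of a single conic *)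

Section Classification.
Variable R : realType.
Implicit Types (p q : quad R) (phi psi : affine_map R) (V : quad R -> Prop).

(** The circle, two parallel lines, the hyperbola and two crossing lines. *)
Definition canon4 V :=
  [\/ V (Quad (-1) 0 0 1 0 1), V (Quad (-1) 0 0 0 0 1),
      V (Quad (-1) 0 0 (-1) 0 1) | V (Quad 0 0 0 (-1) 0 1)].

Definition anticomm : quad R := Quad 0 0 0 0 1 0.

Lemma gt0_sqr (c : R) : 0 < c -> exists2 r, r != 0 & c = r ^+ 2.
Proof.
move=> c0; exists (Num.sqrt c); last by rewrite sqr_sqrtr // ltW.
by rewrite gt_eqF // sqrtr_gt0.
Qed.

Definition aff_diag (r s : R) (r0 : r != 0) (s0 : s != 0) : affine_map R.
refine (@AffineMap R 0 r 0 0 0 s _).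
by rewrite mulr0 subr0 mulf_neq0.
Defined.

Definition aff_antidiag (r s : R) (r0 : r != 0) (s0 : s != 0) : affine_map R.
refine (@AffineMap R 0 0 r 0 s 0 _).
by rewrite mulr0 sub0r oppr_eq0 mulf_neq0.
Defined.

(** Rescaling and exchanging the axes suffice. Both multiply XY + YX by a constant, so in rank 5 the
    relation XY + YX = 0 survives. *)
Lemma diag_canon4 V t (A B : 'M[R]_t) k u w :
  relspace V A B -> V (Quad k 0 0 u 0 w) -> (u != 0) || (w != 0) ->
  exists2 phi, (exists c, qsub anticomm phi = qscale c anticomm)
             & canon4 (pull V phi).
Proof.
move=> rV Vq uw.
have n1 : (1 : R) != 0 := oner_neq0 R.
have diagE (r s : R) (r0 : r != 0) (s0 : s != 0) :
    exists c, qsub anticomm (aff_diag r0 s0) = qscale c anticomm.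
  by exists (r * s); rewrite /qscale /=; congr Quad; ring.
have antidiagE (r s : R) (r0 : r != 0) (s0 : s != 0) :
    exists c, qsub anticomm (aff_antidiag r0 s0) = qscale c anticomm.
  by exists (r * s); rewrite /qscale /=; congr Quad; ring.
have VE p c : p = qscale c (Quad k 0 0 u 0 w) -> V p.
  by move=> ->; apply: relspace_scale rV Vq.
case: (eqVneq w 0) => [w0|w0].
  subst w; rewrite eqxx orbF in uw.
  have : V (Quad (k / u) 0 0 1 0 0).
    by apply: (VE _ u^-1); rewrite /qscale /=; congr Quad; field.
  move/(relspace_pos rV)/(_ ler01 (lexx _)); rewrite n1 => /(_ isT) ku.
  have [|r r0 kr] := @gt0_sqr (- (k / u)); first by rewrite oppr_gt0.
  have rV0 : r^-1 != 0 by rewrite invr_eq0.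
  exists (aff_antidiag n1 rV0); first exact: antidiagE.
  have E : k = - u * r ^+ 2 by rewrite -kr; field.
  subst k.
  apply: Or42; apply: (VE _ (u * r ^+ 2)^-1).
  by rewrite /qscale /=; congr Quad; field; rewrite ?r0 ?uw.
have {}Vq : V (Quad (k / w) 0 0 (u / w) 0 1).
  by apply: (VE _ w^-1); rewrite /qscale /=; congr Quad; field.
have {}VE p c : p = qscale c (Quad (k / w) 0 0 (u / w) 0 1) -> V p.
  by move=> ->; apply: relspace_scale rV Vq.
move: (k / w) (u / w) Vq VE => {uw} {}k {}u Vq VE.
(* Now uX^2 + Y^2 + k = 0: an ellipse for u > 0, a hyperbola or crossing lines for u < 0, parallel
   lines for u = 0. Traces give k < 0 in the first and last case. *)
have [u0|u0|u0] := ltrgt0P u.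
- have k0 : k < 0.
    by apply: (relspace_pos rV Vq); rewrite ?ler01 ?n1 ?orbT // ltW.
  have [|r r0 kr] := @gt0_sqr (- k); first by rewrite oppr_gt0.
  have [s s0 us] := gt0_sqr u0.
  have E : k = - r ^+ 2 by rewrite -kr opprK.
  subst k u.
  have sr0 : s / r != 0 by rewrite mulf_neq0 ?invr_eq0.
  have r10 : r^-1 != 0 by rewrite invr_eq0.
  exists (aff_diag sr0 r10); first exact: diagE.
  apply: Or41; apply: (VE _ (r ^+ 2)^-1); rewrite /qscale /=.
  by congr Quad; field.
- have [|s s0 us] := @gt0_sqr (- u); first by rewrite oppr_gt0.
  have E : u = - s ^+ 2 by rewrite -us opprK.
  subst u.
  have [k0|k0|k0] := ltrgt0P k.
  (* This hyperbola meets the X-axis, so the axes are exchanged. *)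
  + have [r r0 kr] := gt0_sqr k0; subst k.
    have sr0 : s / r != 0 by rewrite mulf_neq0 ?invr_eq0.
    have r10 : r^-1 != 0 by rewrite invr_eq0.
    exists (aff_antidiag r10 sr0); first exact: antidiagE.
    apply: Or43; apply: (VE _ (- r ^+ 2)^-1); rewrite /qscale /=.
    by congr Quad; field; rewrite ?oppr_eq0 ?r0.
  + have [|r r0 kr] := @gt0_sqr (- k); first by rewrite oppr_gt0.
    have E : k = - r ^+ 2 by rewrite -kr opprK.
    subst k.
    have sr0 : s / r != 0 by rewrite mulf_neq0 ?invr_eq0.
    have r10 : r^-1 != 0 by rewrite invr_eq0.
    exists (aff_diag sr0 r10); first exact: diagE.
    apply: Or43; apply: (VE _ (r ^+ 2)^-1); rewrite /qscale /=.
    by congr Quad; field.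
  + subst k; exists (aff_diag s0 n1); first exact: diagE.
    by apply: Or44; apply: (VE _ 1); rewrite /qscale /=; congr Quad; ring.
- subst u.
  have k0 : k < 0 by apply: (relspace_pos rV Vq); rewrite ?ler01 ?n1 ?orbT.
  have [|r r0 kr] := @gt0_sqr (- k); first by rewrite oppr_gt0.
  have E : k = - r ^+ 2 by rewrite -kr opprK.
  subst k.
  have r10 : r^-1 != 0 by rewrite invr_eq0.
  exists (aff_diag n1 r10); first exact: diagE.
  apply: Or42; apply: (VE _ (r ^+ 2)^-1); rewrite /qscale /=.
  by congr Quad; field.
Qed.

Lemma pull_comp V phi psi q :
  pull (pull V phi) psi q = pull V (aff_comp psi phi) q.
Proof. by rewrite /pull qsub_comp. Qed.

(** As [canon4], with the crossing lines rotated to XY + YX = 0. *)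
Definition canon6 V :=
  [\/ V (Quad (-1) 0 0 1 0 1), V (Quad (-1) 0 0 (-1) 0 1),
      V anticomm | V (Quad (-1) 0 0 0 0 1)].

Definition conic_normal V := exists phi, canon6 (pull V phi).

Lemma conic_normal_pull V phi : conic_normal (pull V phi) -> conic_normal V.
Proof.
case=> psi H; exists (aff_comp psi phi).
by rewrite /canon6 -!pull_comp.
Qed.

Definition aff_shift (a d : R) : affine_map R.
refine (@AffineMap R a 1 0 d 0 1 _).
by rewrite mulr0 subr0 mulf_neq0 ?oner_neq0.
Defined.

Definition aff_shear (c : R) : affine_map R.
refine (@AffineMap R 0 1 c 0 0 1 _).
by rewrite mulr0 subr0 mulf_neq0 ?oner_neq0.
Defined.

Definition aff_shear_tr (e : R) : affine_map R.
refine (@AffineMap R 0 1 0 0 e 1 _).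
by rewrite mul0r subr0 mulf_neq0 ?oner_neq0.
Defined.

(** A rotation by 45 degrees up to scale; it turns XY + YX into 2(Y^2 - X^2). *)
Definition aff_rot : affine_map R.
refine (@AffineMap R 0 1 1 0 (-1) 1 _).
by rewrite gt_eqF //; lra.
Defined.

Lemma diag_conic_normal V t (A B : 'M[R]_t) k l m u w :
  relspace V A B -> V (Quad k l m u 0 w) -> (u != 0) || (w != 0) ->
  conic_normal V.
Proof.
move=> rV Vq uw.
(* Completing both squares. If u = 0 the X-shift is 0, as division by 0 gives 0, and l = 0 by
   [relspace_X0]; likewise for w and m. *)
pose psi := aff_shift (- l / u / 2) (- m / w / 2).
have E : exists k', qsub (Quad k l m u 0 w) psi = Quad k' 0 0 u 0 w.
  eexists; rewrite /=; congr Quad; try by ring.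
    rewrite !(mulr0, mul0r, mul0rn, addr0, add0r).
    case: (eqVneq u 0) => [u0|u0]; last by field.
    by subst u; rewrite (relspace_X0 rV Vq); ring.
  rewrite !(mulr0, mul0r, mul0rn, addr0, add0r).
  case: (eqVneq w 0) => [w0|w0]; last by field.
  by subst w; rewrite (relspace_Y0 rV Vq); ring.
case: E => k' E.
have rV' := relspace_pull (aff_inv psi) rV.
have := pull_inv psi Vq; rewrite E => Vq'.
apply: (@conic_normal_pull _ (aff_inv psi)).
have [phi _ H] := diag_canon4 rV' Vq' uw.
case: H => H;
  try by exists phi; first [exact: Or41|exact: Or42|exact: Or43|exact: Or44].
apply: (@conic_normal_pull _ phi); exists aff_rot; apply: Or43.
have rV'' := relspace_pull phi rV'.
have := relspace_scale 2 rV'' H; congr pull.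
by rewrite /pull /qscale /=; congr Quad; ring.
Qed.

(** If the form has a square term, a shear removes XY + YX; otherwise it is a nonzero multiple of XY
    + YX, and [aff_rot] diagonalizes it. *)
Lemma rank6_normal V t (A B : 'M[R]_t) p :
  relspace V A B -> V p -> p <> @qzero R -> conic_normal V.
Proof.
move=> rV; case: p => k l m u v w Vp p0.
have step psi : let q := qsub (Quad k l m u v w) psi in
    qXY q = 0 -> (qXX q != 0) || (qYY q != 0) -> conic_normal V.
  move=> q E uw; apply: (@conic_normal_pull _ (aff_inv psi)).
  apply: (@diag_conic_normal _ _ _ _ (q1 q) (qX q) (qY q) _ _
    (relspace_pull (aff_inv psi) rV) _ uw).
  have := pull_inv psi Vp; rewrite -/q; congr pull.
  by move: E; case: (q) => ? ? ? ? ? ? /= ->.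
case: (eqVneq u 0) => [u0|u0].
  subst u; case: (eqVneq w 0) => [w0|w0].
    subst w; case: (eqVneq v 0) => [v0|v0].
      by subst v; case: p0; exact: (relspace_linear0 rV Vp).
    have := step aff_rot; rewrite /=; apply; first by ring.
    apply/orP; left.
    by have -> : 0 * 1 ^+ 2 + v * (1 * -1) *+ 2 + 0 * (-1) ^+ 2 = - (v *+ 2)
      by [ring]; rewrite oppr_eq0 mulrn_eq0.
  have := step (aff_shear_tr (- v / w)); rewrite /=; apply; first by field.
  by rewrite !(mul0r, mul0rn, mulr0, add0r) expr1n mulr1 w0 orbT.
have := step (aff_shear (- v / u)); rewrite /=; apply; first by field.
by rewrite expr1n mulr1 expr0n !(mulr0, mul0rn, addr0) u0.
Qed.

End Classification.

(** * Pencils of conics and the relation XY + YX = 0 *)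

Section Pencils.
Variable R : realType.
Implicit Types (p q : quad R) (phi psi : affine_map R) (V : quad R -> Prop).

(* For a linear space V this says that its dimension is at least 2. *)
Definition pencil V :=
  V (@qzero R) /\ forall p, V p -> exists2 q, V q & forall s, q <> qscale s p.

Lemma pencil_pull V phi : pencil V -> pencil (pull V phi).
Proof.
case=> V0 Vp; split.
  rewrite /pull; congr V: V0; case: phi => a b c d e f nd.
  by rewrite /qzero /=; congr Quad; ring.
move=> p /Vp [q Vq nq]; exists (qsub q (aff_inv phi)).
  by rewrite /pull qsub_invK.
move=> s E; apply: (nq s).
by rewrite -[q](qsub_invK _ phi) E qsub_scale.
Qed.

Definition pencil_normal V :=
  exists2 phi, pull V phi (anticomm R) & canon4 (pull V phi).

Lemma pencil_normal_pull V phi : pencil_normal (pull V phi) -> pencil_normal V.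
Proof.
case=> psi H1 H2; exists (aff_comp psi phi); first by rewrite -pull_comp.
by rewrite /canon4 -!pull_comp.
Qed.

(** A second member, freed of its XY + YX term, has no linear part by [relspace_anticomm]. A
    constant would have to be 0, making the two members proportional. *)
Lemma pencil_diag V t (A B : 'M[R]_t) k :
  relspace V A B -> pencil V -> V (Quad k 0 0 0 1 0) ->
  exists c u w, V (Quad c 0 0 u 0 w) /\ ((u != 0) || (w != 0)).
Proof.
move=> rV [_ pV] Vp; have [[c l m u v w] Vq nq] := pV _ Vp.
have [_ _ li] := rV.
have {Vq} : V (Quad (c - v * k) l m u 0 w).
  by have := li 1 _ (- v) _ Vq Vp; congr V; rewrite /qlin /=; congr Quad; ring.
move=> Vq; have [l0 m0] := relspace_anticomm rV Vp Vq; subst l m.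
exists (c - v * k), u, w; split => //.
apply/norP => -[/negPn/eqP u0 /negPn/eqP w0]; subst u w.
have [/subr0_eq ck] := relspace_linear0 rV Vq.
by apply: (nq v); rewrite /qscale ck /=; congr Quad; ring.
Qed.

Lemma pencil_anticomm V t (A B : 'M[R]_t) :
  relspace V A B -> pencil V -> V (anticomm R) -> pencil_normal V.
Proof.
move=> rV pV Va; have [c [u [w [Vq uw]]]] := pencil_diag rV pV Va.
have [phi [s E] H] := diag_canon4 rV Vq uw.
by exists phi => //; rewrite /pull E; apply: relspace_scale rV Va.
Qed.

(** Minus the determinant of the quadratic part: positive exactly when that part is indefinite. *)
Definition disc p := qXY p ^+ 2 - qXX p * qYY p.

(* Over the reals, a form u X^2 + v (XY + YX) + w Y^2 with v^2 > u w is a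
   symmetrized product of two independent linear forms; these are the new
   coordinates. *)
Lemma disc_split p : 0 < disc p ->
  exists psi k l m v, [/\ qsub p psi = Quad k l m 0 v 0, v != 0
    & q1 p = 0 -> qX p = 0 -> qY p = 0 -> [/\ k = 0, l = 0 & m = 0]].
Proof.
case: p => k l m u v w; rewrite /disc /= => D.
case: (eqVneq u 0) => [u0|u0].
  (* The form is (PQ + QP)/2 with P = 2vX + wY and Q = Y. *)
  subst u; have v0 : v != 0.
    by apply: contraTneq D => ->; rewrite mul0r expr0n subr0 ltxx.
  have nd : (v * 2)^-1 * 1 - - w / (v * 2) * 0 != 0.
    by rewrite mulr0 mulr1 subr0 invr_eq0 mulf_neq0 ?pnatr_eq0.
  exists (AffineMap 0 0 nd), k, (l / (v * 2)), (m - l * w / (v * 2)), 2^-1.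
  split; last by move=> -> -> ->; split; ring.
    by rewrite /=; congr Quad; field.
  by rewrite invr_eq0 pnatr_eq0.
(* With d^2 = v^2 - uw, the form is (PQ + QP)/(2u) for P = uX + (v + d)Y and Q = uX + (v - d)Y; the
   map below expresses X and Y through P and Q. *)
have [d d0 E] := gt0_sqr D.
have {}E : w = (v ^+ 2 - d ^+ 2) / u by rewrite -E; field.
have nd : (v - d) / (- 2 * u * d) * (- (2 * d)^-1)
          - - (v + d) / (- 2 * u * d) * (2 * d)^-1 != 0.
  have -> : (v - d) / (- 2 * u * d) * (- (2 * d)^-1)
          - - (v + d) / (- 2 * u * d) * (2 * d)^-1 = - (2 * u * d)^-1.
    by field; rewrite u0 d0.
  by rewrite oppr_eq0 invr_eq0 !mulf_neq0 ?pnatr_eq0.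
subst w; exists (AffineMap 0 0 nd), k.
exists (l * ((v - d) / (- 2 * u * d)) + m * (2 * d)^-1).
exists (- l * ((v + d) / (- 2 * u * d)) - m * (2 * d)^-1), (2 * u)^-1.
split; last by move=> -> -> ->; split; ring.
  by rewrite /=; congr Quad; field; rewrite ?u0 ?d0.
by rewrite invr_eq0 mulf_neq0 ?pnatr_eq0.
Qed.

(** Otherwise the form is semidefinite, and a change of coordinates gives a relation between squares
    with constant 0, against [relspace_pos]. *)
Lemma disc_homogeneous V t (A B : 'M[R]_t) u v w :
  relspace V A B -> V (Quad 0 0 0 u v w) ->
  Quad 0 0 0 u v w <> @qzero R -> 0 < disc (Quad 0 0 0 u v w).
Proof.
move=> rV Vp p0; rewrite /disc /=; case: (eqVneq u 0) => [u0|u0].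
  subst u; rewrite mul0r subr0 lt_def sqr_ge0 andbT sqrf_eq0.
  apply: contra_not_neq p0 => v0; subst v.
  case: (eqVneq w 0) => [w0|w0]; first by subst w.
  have := relspace_scale w rV Vp; rewrite /qscale /= !mulr0 => Vw.
  suff : (0 : R) < 0 by rewrite ltxx.
  apply: (relspace_pos rV Vw); rewrite ?lexx ?mulf_neq0 ?orbT //.
  by rewrite -expr2 sqr_ge0.
rewrite ltNge; apply/negP => D.
pose psi := aff_shear (- v / u).
(* The factor u makes the coefficient of X^2 a square, whatever the sign of u. *)
have E : qsub (qscale u (Quad 0 0 0 u v w)) psi =
         Quad 0 0 0 (u ^+ 2) 0 (u * w - v ^+ 2).
  by rewrite /qscale /=; congr Quad; field.
have := pull_inv psi (relspace_scale u rV Vp); rewrite E => VE.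
suff : (0 : R) < 0 by rewrite ltxx.
apply: (relspace_pos (relspace_pull (aff_inv psi) rV) VE).
- exact: sqr_ge0.
- by rewrite -oppr_le0 opprB.
- by rewrite sqrf_eq0 u0.
Qed.

Lemma pencil_homogeneous V t (A B : 'M[R]_t) p :
  relspace V A B -> pencil V -> V p -> 0 < disc p ->
  q1 p = 0 -> qX p = 0 -> qY p = 0 -> pencil_normal V.
Proof.
move=> rV pV Vp D k0 l0 m0.
have [psi [k [l [m [v [E v0 H]]]]]] := disc_split D.
have [? ? ?] := H k0 l0 m0; subst k l m.
have rV' := relspace_pull (aff_inv psi) rV.
have := pull_inv psi Vp; rewrite E => /(relspace_scale v^-1 rV').
rewrite /qscale /= !mulr0 mulVf // => Va.
apply: (@pencil_normal_pull _ (aff_inv psi)).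
exact: pencil_anticomm rV' (pencil_pull _ pV) Va.
Qed.

Lemma pencil_anticomm_const V t (A B : 'M[R]_t) k :
  relspace V A B -> pencil V -> V (Quad k 0 0 0 1 0) -> pencil_normal V.
Proof.
move=> rV pV Va; case: (eqVneq k 0) => [k0|k0].
  by subst k; apply: pencil_anticomm rV pV Va.
have [c [u [w [Vq uw]]]] := pencil_diag rV pV Va.
have [_ _ li] := rV.
(* c times the first relation minus k times the second: the constants cancel. *)
have {}Vq : V (Quad 0 0 0 (- k * u) c (- k * w)).
  have := li c _ (- k) _ Va Vq; congr V.
  by rewrite /qlin /=; congr Quad; ring.
apply: (pencil_homogeneous rV pV Vq) => //.
apply: (disc_homogeneous rV Vq) => -[/eqP ku _ /eqP kw].
move: ku kw uw; rewrite !mulf_eq0 oppr_eq0 (negbTE k0) /=.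
by move=> /eqP -> /eqP ->; rewrite eqxx.
Qed.

Lemma pencil_disc V t (A B : 'M[R]_t) p :
  relspace V A B -> pencil V -> V p -> 0 < disc p -> pencil_normal V.
Proof.
move=> rV pV Vp D.
have [psi [k [l [m [v [E v0 _]]]]]] := disc_split D.
have rV' := relspace_pull (aff_inv psi) rV.
have pV' := pencil_pull (aff_inv psi) pV.
have := pull_inv psi Vp; rewrite E => /(relspace_scale v^-1 rV').
rewrite /qscale /= !mulr0 mulVf // => Va.
apply: (@pencil_normal_pull _ (aff_inv psi)).
move: (pull _ _) (actX _ _ _) (actY _ _ _) (v^-1 * k) (v^-1 * l) (v^-1 * m)
  rV' pV' Va => {rV pV Vp E v0 v D psi p k l m A B}V A B k l m rV pV Va.
(* The centre of XY + YX + lX + mY + k = 0 is (-m/2, -l/2). *)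
pose psi := aff_shift (- m / 2) (- l / 2).
have E : qsub (Quad k l m 0 1 0) psi = Quad (k - l * m / 2) 0 0 0 1 0.
  by rewrite /=; congr Quad; field.
apply: (@pencil_normal_pull _ (aff_inv psi)).
have := pull_inv psi Va; rewrite E.
exact: pencil_anticomm_const (relspace_pull _ rV) (pencil_pull _ pV).
Qed.

(** Eliminate X^2 between two members. A remaining XY + YX term gives a positive discriminant at
    once. If no quadratic term remains, the result is 0, so by independence X^2 is absent from both
    members, and one of them contains XY + YX. *)
Lemma pencil_disc_ex V t (A B : 'M[R]_t) :
  relspace V A B -> pencil V -> exists2 p, V p & 0 < disc p.
Proof.
move=> rV [V0 pV].
have [[k l m u v w] Vp np] := pV _ V0.
have p0 : Quad k l m u v w <> @qzero R.
  by move=> E; apply: (np 0); rewrite E /qscale /qzero /=; congr Quad; ring.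
have [[k' l' m' u' v' w'] Vq nq] := pV _ Vp.
have [_ _ li] := rV.
have sq (x : R) : x != 0 -> 0 < x ^+ 2.
  by move=> x0; rewrite lt_def sqrf_eq0 x0 sqr_ge0.
have two r : V r -> qXX r = 0 -> qXY r != 0 -> exists2 p, V p & 0 < disc p.
  by move=> Vr r0 r1; exists r => //; rewrite /disc r0 mul0r subr0 sq.
have Vr := li u' _ (- u) _ Vp Vq.
have rXX : qXX (qlin u' (Quad k l m u v w) (- u) (Quad k' l' m' u' v' w')) = 0.
  by rewrite /=; ring.
have [r1|r1] := eqVneq (qXY (qlin u' (Quad k l m u v w) (- u)
  (Quad k' l' m' u' v' w'))) 0; last exact: two Vr rXX r1.
have [r2|r2] := eqVneq (qYY (qlin u' (Quad k l m u v w) (- u)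
  (Quad k' l' m' u' v' w'))) 0.
  (* The two quadratic parts are now dependent. *)
  move: Vr rXX r1 r2; rewrite /qlin /= => Vr rXX r1 r2.
  rewrite rXX r1 r2 in Vr; have [E1 E2 E3] := relspace_linear0 rV Vr.
  case: (eqVneq u 0) => [u0|u0]; last first.
    case: (nq (u' / u)); rewrite /qscale /=.
    by congr Quad; apply: (mulfI u0); apply/eqP; rewrite eq_sym -subr_eq0;
       [rewrite -E1|rewrite -E2|rewrite -E3|rewrite -rXX|rewrite -r1
       |rewrite -r2]; apply/eqP; field.
  subst u; case: (eqVneq u' 0) => [u0|u0]; last first.
    case: p0; move: E1 E2 E3 rXX r1 r2; rewrite !oppr0 !mul0r !addr0.
    move=> /eqP + /eqP + /eqP + _ /eqP + /eqP.
    rewrite !mulf_eq0 (negbTE u0) /=.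
    by do 5!move=> /eqP ->.
  subst u'; case: (eqVneq v 0) => [v0|v0]; last exact: two Vp _ v0.
  case: (eqVneq v' 0) => [v0'|v0']; last exact: two Vq _ v0'.
  subst v v'; case: (eqVneq w 0) => [w0|w0].
    by subst w; case: p0; apply: (relspace_linear0 rV Vp).
  (* Both quadratic parts are multiples of Y^2; eliminating it leaves an affine relation, hence 0,
     and the members are proportional. *)
  have {}Vr := li (- w' / w) _ 1 _ Vp Vq.
  have F : - w' / w * w + 1 * w' = 0 by field.
  move: Vr; rewrite /qlin /= F !mulr0 !addr0 => Vr.
  have [F1 F2 F3] := relspace_linear0 rV Vr.
  case: (nq (w' / w)); rewrite /qscale /= !mulr0.
  by congr Quad; apply/eqP; rewrite -subr_eq0 ?divfK ?subrr //;
    [rewrite -F1|rewrite -F2|rewrite -F3]; apply/eqP; ring.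
(* The pencil contains a form c Y^2 with c <> 0, and adding a multiple of it
   to a form with a nonzero X^2 coefficient makes the discriminant positive. *)
have [s Vs s0] : exists2 s, V s & qXX s != 0.
  case: (eqVneq u 0) => [u0|u0]; last by exists (Quad k l m u v w).
  case: (eqVneq u' 0) => [u0'|u0']; last by exists (Quad k' l' m' u' v' w').
  by move: r2; rewrite /= u0 u0' oppr0 !mul0r addr0 eqxx.
move: Vr r2 r1 rXX; move: (qlin _ _ _ _) => r Vr r2 r1 rXX.
(* This multiple makes the coefficients of X^2 and Y^2 opposite, so the discriminant is a sum of two
   squares. *)
exists (qlin 1 s (- (qXX s + qYY s) / qYY r) r); first exact: li.
rewrite /disc /= r1 rXX.
have -> : (1 * qXY s + - (qXX s + qYY s) / qYY r * 0) ^+ 2 -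
  (1 * qXX s + - (qXX s + qYY s) / qYY r * 0) *
  (1 * qYY s + - (qXX s + qYY s) / qYY r * qYY r)
  = qXY s ^+ 2 + qXX s ^+ 2 by field.
by apply: ltr_wpDl; [exact: sqr_ge0|exact: sq].
Qed.

Lemma rank5_normal V t (A B : 'M[R]_t) :
  relspace V A B -> pencil V -> pencil_normal V.
Proof.
move=> rV pV; have [p Vp D] := pencil_disc_ex rV pV.
exact: pencil_disc rV pV Vp D.
Qed.

End Pencils.

(** * Moments of the transformed sequence *)

Section Transform.
Variable R : realType.
Implicit Types (beta : word -> R) (phi : affine_map R) (mu : measure R).

Definition act_measure phi mu : measure R :=
  Measure (fun i => actX phi (atomX (m := mu) i) (atomY i))
          (fun i => actY phi (atomX (m := mu) i) (atomY i)) (weight (m := mu)).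

Definition moment mu (w : word) : R :=
  \sum_i weight (m := mu) i * ntrace (weval (atomX i) (atomY i) w).

Lemma ntraceD t (A B : 'M[R]_t) : ntrace (A + B) = ntrace A + ntrace B.
Proof. by rewrite /ntrace mxtraceD mulrDl. Qed.

Lemma ntraceZ t a (A : 'M[R]_t) : ntrace (a *: A) = a * ntrace A.
Proof. by rewrite /ntrace mxtraceZ mulrA. Qed.

Lemma weval_cons (S : pzRingType) (x y : S) l (w : seq bool) :
  weval x y (FMonom (l :: w)) =
  (if l == letterX then x else y) * weval x y (FMonom w).
Proof. by rewrite /weval big_cons. Qed.

Lemma weval_cat (S : pzRingType) (x y : S) (v w : seq bool) :
  weval x y (FMonom (v ++ w)) = weval x y (FMonom v) * weval x y (FMonom w).
Proof. by rewrite /weval big_cat. Qed.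

Lemma weval_nil (S : pzRingType) (x y : S) : weval x y w1 = 1.
Proof. by rewrite /weval big_nil. Qed.

Lemma weval_rev t (A B : 'M[R]_t) (w : seq bool) : A^T = A -> B^T = B ->
  weval A B (FMonom (rev w)) = (weval A B (FMonom w))^T.
Proof.
move=> sA sB; elim: w => [|l w IH]; first by rewrite weval_nil trmx1.
rewrite rev_cons -cats1 weval_cat IH weval_cons weval_cons weval_nil mulr1.
by rewrite trmx_mul; case: ifP => _; rewrite ?sA ?sB.
Qed.

(** Here [mmap idfun h] is just the linear extension of h, so left multiplication by a word shifts
    the argument of h. *)
Lemma mmap_mulU (h : word -> R) (c : R) (k : word) (g : ncpoly R) :
  mmap idfun h (<< c *g k >> * g) = c * mmap idfun (fun m => h (wcat k m)) g.
Proof.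
rewrite [_ * _]fgmulUg raddf_sum mmapE mulr_sumr; apply: eq_bigr => m _.
rewrite [LHS]mmapU /= mulrA; congr (_ * h _).
by rewrite /mmul /= fmmulE.
Qed.

Lemma mmap_mul_affine (h : word -> R) (a b c : R) (g : ncpoly R) :
  mmap idfun h ((<< a *g w1 >> + << b *g wX >> + << c *g wY >>) * g) =
  a * mmap idfun (fun m => h (wcat w1 m)) g
  + b * mmap idfun (fun m => h (wcat wX m)) g
  + c * mmap idfun (fun m => h (wcat wY m)) g.
Proof.
have D (p q : ncpoly R) :
    mmap idfun h (p + q) = mmap idfun h p + mmap idfun h q.
  exact: mmapD.
rewrite (mulrDl (<< a *g w1 >> + << b *g wX >>)) (mulrDl << a *g w1 >>).
rewrite (D (_ + _) _) (D (_ * _) _).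
by congr (_ + _ + _); apply: mmap_mulU.
Qed.

Lemma mmap_one (h : word -> R) : mmap idfun h (1 : ncpoly R) = h w1.
Proof.
have -> : (1 : ncpoly R) = << 1 *g fmone bool >> by [].
by rewrite fmoneE mmapU mul1r.
Qed.

Lemma eq_mmap (h h' : word -> R) (g : ncpoly R) : h =1 h' ->
  mmap idfun h g = mmap idfun h' g.
Proof. by move=> E; apply: eq_bigr => k _; rewrite E. Qed.

Lemma transform_moment beta mu phi (w : word) :
  represents mu beta -> (wlen w <= 4)%N ->
  transform phi beta w = moment (act_measure phi mu) w.
Proof.
case=> _ _ mom.
(* Induction on the part s not yet expanded; u collects the original letters already produced. The
   bound keeps every word within length 4, where [mu] gives the moments. *)
suff H (s u : seq bool) : (size u + size s <= 4)%N ->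
    mmap idfun (fun m => beta (wcat (FMonom u) m)) (wcomp (FMonom s) phi) =
    \sum_i weight (m := mu) i * ntrace (weval (atomX i) (atomY i) (FMonom u) *
      weval (actX phi (atomX i) (atomY i)) (actY phi (atomX i) (atomY i))
        (FMonom s)).
  move=> w4; rewrite /transform /riesz -[w]fmK.
  rewrite (@eq_mmap _ (fun m => beta (wcat (FMonom [::]) m))).
    rewrite H //; apply: eq_bigr => i _; congr (_ * ntrace _).
    by rewrite weval_nil mul1r.
  by move=> m; rewrite /wcat /= fmK.
elim: s u => [|l s IH] u us.
  rewrite /wcomp weval_nil mmap_one /wcat cats0.
  rewrite mom; last by rewrite addn0 in us.
  by apply: eq_bigr => i _; rewrite weval_nil mulr1.
rewrite /wcomp weval_cons -/(wcomp (FMonom s) phi).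
have step (a b c : R) :
  mmap idfun (fun m => beta (wcat (FMonom u) m))
    ((<< a *g w1 >> + << b *g wX >> + << c *g wY >>) * wcomp (FMonom s) phi) =
  \sum_i weight (m := mu) i * ntrace (weval (atomX i) (atomY i) (FMonom u) *
     ((a *: 1%:M + b *: atomX i + c *: atomY i) *
      weval (actX phi (atomX i) (atomY i)) (actY phi (atomX i) (atomY i))
        (FMonom s))).
  rewrite mmap_mul_affine.
  have E (v : seq bool) : (size v <= 1)%N ->
     mmap idfun (fun m => beta (wcat (FMonom u) (wcat (FMonom v) m)))
       (wcomp (FMonom s) phi) =
     \sum_i weight (m := mu) i *
      ntrace (weval (atomX i) (atomY i) (FMonom (u ++ v)) *
      weval (actX phi (atomX i) (atomY i)) (actY phi (atomX i) (atomY i))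
        (FMonom s)).
    move=> v1; rewrite -IH.
      by apply: eq_mmap => m; rewrite /wcat /= catA.
    rewrite size_cat -addnA (leq_trans _ us) // leq_add2l.
    by rewrite -[size (_ :: _)]add1n leq_add2r.
  rewrite (E [::]) // (E [:: letterX]) // (E [:: letterY]) //.
  rewrite !mulr_sumr -!big_split; apply: eq_bigr => i _ /=.
  rewrite !weval_cat !weval_cons !weval_nil !mulr1 /=.
  rewrite -!mulmxE !mulmxDl !mulmxDr.
  rewrite -!scalemxAl -!scalemxAr !ntraceD !ntraceZ mul1mx !mulmxA.
  ring.
by case: l us => us; rewrite /= step; apply: eq_bigr => i _; rewrite weval_cons.
Qed.

End Transform.

(** * From the kernel of the moment matrix to relations at the atoms, and back to columns *)

Section Kernel.
Variables (R : realType) (beta : word -> R) (mu : measure R).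
Hypothesis rep : represents mu beta.

Definition vanishes (mu : measure R) (q : quad R) : Prop :=
  forall i, qeval (atomX (m := mu) i) (atomY i) q = 0.

Lemma size_index_words i : (size (tnth index_words i) <= 2)%N.
Proof.
have /allP := isT : all (fun w : word => size w <= 2)%N index_words.
by apply; apply: mem_tnth.
Qed.

Lemma nc_atom : beta wXXYY <> beta wXYXY ->
  exists i, nc_pair (atomX (m := mu) i) (atomY i).
Proof.
case: rep => pos _ mom nc.
case: (pickP (fun i => atomX (m := mu) i *m atomY i - atomY i *m atomX i != 0)).
  by move=> i ni; exists i; case: (pos i) => _ sA sB _; split.
move=> comm; case: nc; rewrite !mom //; apply: eq_bigr => i _.
congr (_ * ntrace _); rewrite !weval_cons weval_nil /= !mulr1 -!mulmxE.
have /negbFE := comm i; rewrite subr_eq0 => /eqP E.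
by rewrite (mulmxA (atomX i) (atomY i) (atomY i)) {1}E -mulmxA.
Qed.

(** u M u^T is the weighted sum of the normalized traces of P_i^T P_i; these are nonnegative, so
    each vanishes. *)
Lemma kernel_atoms (u : 'rV[R]_7) : u *m moment_matrix beta = 0 ->
  forall i, \sum_j u 0 j *:
    weval (atomX (m := mu) i) (atomY i) (tnth index_words j) = 0.
Proof.
case: rep => pos _ mom uM.
pose P i := \sum_j u 0 j *:
  weval (atomX (m := mu) i) (atomY i) (tnth index_words j).
have E : \sum_i weight (m := mu) i * ntrace ((P i)^T *m P i) = 0.
  transitivity ((u *m moment_matrix beta *m u^T) 0 0); last first.
    by rewrite uM mul0mx mxE.
  rewrite mxE.
  under [RHS]eq_bigr => k _ do rewrite !mxE mulr_suml.
  transitivity (\sum_k \sum_j \sum_i u 0 j * u 0 k * (weight (m := mu) i *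
     ntrace ((weval (atomX i) (atomY i) (tnth index_words j))^T *m
       weval (atomX i) (atomY i) (tnth index_words k)))); last first.
    apply: eq_bigr => k _; apply: eq_bigr => j _; rewrite mxE mom.
      rewrite mulr_sumr mulr_suml; apply: eq_bigr => i _.
      case: (pos i) => _ sA sB _.
      rewrite weval_cat weval_rev // fmK -mulmxE; ring.
    rewrite /wlen /= size_cat size_rev.
    by rewrite (leq_add (size_index_words _) (size_index_words _)).
  under [RHS]eq_bigr => k _ do rewrite exchange_big.
  rewrite exchange_big; apply: eq_bigr => i _ /=.
  rewrite /P mulmx_sumr /ntrace !raddf_sum /= mulr_suml mulr_sumr.
  apply: eq_bigr => k _.
  rewrite mulmx_suml raddf_sum /=.
  rewrite mulr_suml mulr_sumr; apply: eq_bigr => j _.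
  by rewrite [(_ *: _)^T]linearZ /= -scalemxAl -scalemxAr !mxtraceZ; ring.
move=> i; apply: mxtrace_gram_eq0; rewrite -/(P i).
have ge0 j : true -> 0 <= weight (m := mu) j * ntrace ((P j)^T *m P j).
  move=> _; case: (pos j) => sz _ _ w0; apply: mulr_ge0; first exact: ltW.
  by rewrite /ntrace divr_ge0 ?mxtrace_gram_ge0 ?ler0n.
have := psumr_eq0P ge0 E (i := i) isT; case: (pos i) => sz _ _ w0 /eqP.
rewrite mulf_eq0 gt_eqF //= /ntrace mulf_eq0 invr_eq0 pnatr_eq0.
by rewrite (gtn_eqF sz) orbF => /eqP.
Qed.

(* Entry 5 (the word YX) is dropped: on the kernel it equals entry 4 (XY). *)
Definition quad_of (u : 'rV[R]_7) : quad R :=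
  let c k := u 0 (inord k) in Quad (c 0) (c 1) (c 2) (c 3) (c 4) (c 6).

Definition row_of (q : quad R) : 'rV[R]_7 :=
  \row_j [:: q1 q; qX q; qY q; qXX q; qXY q; qXY q; qYY q]`_j.

(** Transposing the relation at a noncommuting atom exchanges AB and BA; subtracting gives (c_4 -
    c_5)(AB - BA) = 0. Hence [quad_of] loses nothing on the kernel. *)
Lemma kernel_vanishes (u : 'rV[R]_7) : beta wXXYY <> beta wXYXY ->
  u *m moment_matrix beta = 0 ->
  vanishes mu (quad_of u) /\ row_of (quad_of u) = u.
Proof.
move=> nc uM; have ker := kernel_atoms uM; have [pos _ _] := rep.
pose c k := u 0 (inord k).
have E i : let A := atomX (m := mu) i in let B := atomY (m := mu) i in
    c 0 *: 1%:M + c 1 *: A + c 2 *: B + c 3 *: (A *m A)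
    + c 4 *: (A *m B) + c 5 *: (B *m A) + c 6 *: (B *m B) = 0.
  rewrite /= -[RHS](ker i) 7!big_ord_recl big_ord0.
  rewrite !(tnth_nth w1) /= !weval_cons !weval_nil /= -!mulmxE !mulmx1.
  rewrite /c addr0 !addrA.
  by do !congr (_ + _); congr (u 0 _ *: _); apply: val_inj; rewrite /= inordK.
have [i0 [sA sB nAB]] := nc_atom nc.
have c45 : c 4 = c 5.
  apply/eqP; rewrite -subr_eq0.
  suff /eqP : (c 4 - c 5) *: (atomX i0 *m atomY i0 - atomY i0 *m atomX i0) = 0.
    by rewrite scaler_eq0 (negbTE nAB) orbF.
  have := E i0; have := congr1 trmx (E i0).
  rewrite /= trmx0 !linearD !linearZ /= trmx1 !trmx_mul sA sB.
  move: (atomX i0) (atomY i0) (_ *m _) (_ *m _) (_ *m _) (_ *m _) 1%:M.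
  move=> A B AA BA AB BB I /matrixP E1 /matrixP E2; apply/matrixP=> i j.
  by have := E1 i j; have := E2 i j; rewrite !mxE => F1 F2; lra.
split.
  move=> i; rewrite -[RHS](E i) /qeval /= -/(c 0%N) -/(c 1%N) -/(c 2%N).
  by rewrite -/(c 3) -/(c 4) -/(c 6) -c45 scalerDr !addrA.
have cE k (k7 : (k < 7)%N) : c k = u 0 (Ordinal k7).
  by congr (u 0 _); apply: val_inj; rewrite /= inordK.
apply/rowP=> j; rewrite mxE.
case: j => -[|[|[|[|[|[|[|k]]]]]]] // k7 /=; try exact: cE.
by rewrite -/(c 4) c45.
Qed.

Lemma vanishes_relspace i : nc_pair (atomX (m := mu) i) (atomY i) ->
  relspace (vanishes mu) (atomX (m := mu) i) (atomY i).
Proof.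
move=> nAB; split => // s p r q Vp Vq j.
by rewrite qeval_lin Vp Vq !scaler0 addr0.
Qed.

Lemma rank6_quad : beta wXXYY <> beta wXYXY ->
  \rank (moment_matrix beta) = 6%N -> exists2 q, vanishes mu q & q <> @qzero R.
Proof.
move=> nc rk.
have : kermx (moment_matrix beta) != 0 by rewrite -mxrank_eq0 mxrank_ker rk.
case/rowV0Pn => u /sub_kermxP /(kernel_vanishes nc) [Vu Eu] u0.
exists (quad_of u) => // q0; case/eqP: u0; rewrite -Eu q0.
by apply/rowP => j; rewrite !mxE; case: j => -[|[|[|[|[|[|[|]]]]]]].
Qed.

(** The kernel has dimension 2, so some kernel row lies outside the span of [row_of p]. *)
Lemma rank5_pencil : beta wXXYY <> beta wXYXY ->
  \rank (moment_matrix beta) = 5%N -> pencil (vanishes mu).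
Proof.
move=> nc rk; split.
  by move=> i; rewrite /qeval /= !scale0r !addr0.
move=> p Vp.
have : ~~ (kermx (moment_matrix beta) <= row_of p)%MS.
  apply/negP => /mxrankS; rewrite mxrank_ker rk => le2.
  by have := leq_trans le2 (rank_leq_row _).
case/row_subPn => k nk.
have /sub_kermxP uM := row_sub k (kermx (moment_matrix beta)).
have [Vu Eu] := kernel_vanishes nc uM.
exists (quad_of (row k (kermx (moment_matrix beta)))) => // s qs.
move/negP: nk; apply; rewrite -Eu qs.
have -> : row_of (qscale s p) = s *: row_of p.
  by apply/rowP => j; rewrite !mxE; case: j => -[|[|[|[|[|[|[|]]]]]]].
exact: scalemx_sub.
Qed.

Lemma mcolE (b : word -> R) w (k : 'I_7) (l : 'I_1) : w \in index_words ->
  mcol b w k l = b (wcat (wrev (tnth index_words k)) w).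
Proof.
move=> iw; rewrite !mxE; congr (b (wcat _ _)).
rewrite (tnth_nth w1) inordK ?nth_index //.
by rewrite -index_mem size_tuple in iw.
Qed.

(** The entry in row U is the moment of U^* q, and each moved atom contributes the trace of a
    multiple of q(A, B) = 0. *)
Lemma vanishes_columns phi q : vanishes (act_measure phi mu) q ->
  let M := mcol (transform phi beta) in
  q1 q *: M w1 + qX q *: M wX + qY q *: M wY + qXX q *: M wXX
  + qXY q *: (M wXY + M wYX) + qYY q *: M wYY = 0.
Proof.
move=> Vq M.
have ME w k : w \in index_words -> (wlen w <= 2)%N -> M w k 0 = \sum_i
    weight (m := mu) i * ntrace (weval (actX phi (atomX i) (atomY i))
      (actY phi (atomX i) (atomY i)) (wrev (tnth index_words k)) *
    weval (actX phi (atomX i) (atomY i)) (actY phi (atomX i) (atomY i)) w).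
  move=> iw w2; rewrite mcolE // (transform_moment phi rep).
    by apply: eq_bigr => i _; rewrite weval_cat !fmK.
  rewrite /wlen /= size_cat size_rev.
  by rewrite (leq_add (size_index_words _) w2).
clearbody M; apply/colP=> k; rewrite ![in LHS]mxE !ME // [RHS]mxE.
rewrite -!big_split !mulr_sumr -!big_split /= big1 // => i _.
have E : qeval (actX phi (atomX i) (atomY i))
           (actY phi (atomX i) (atomY i)) q = 0 by exact: Vq.
rewrite !weval_cons !weval_nil /= -!mulmxE !mulmx1.
move: (actX _ _ _) (actY _ _ _) E => A B E; move: (weval A B _) => W.
transitivity (weight (m := mu) i * ntrace (W *m qeval A B q)).
  rewrite /qeval !mulmxDr -!scalemxAr !mulmxDr !ntraceD !ntraceZ !ntraceD.
  by rewrite mulmx1; ring.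
by rewrite E mulmx0 /ntrace mxtrace0 mul0r mulr0.
Qed.

End Kernel.

(** * Normal forms read as column relations *)

Theorem proposition4p1 (R : realType) (beta : word -> R)
    (beta_nc : is_nc_sequence beta)
    (rank56 : \rank (moment_matrix beta) = 5%N \/
              \rank (moment_matrix beta) = 6%N)
    (nc_measure : admits_nc_measure beta) :
  exists phi : affine_map R,
    let M := mcol (transform phi beta) in
    (\rank (moment_matrix beta) = 5%N ->
       M wXY + M wYX = 0 /\
       [\/ M wXX + M wYY = M w1,
           M wYY = M w1,
           M wYY - M wXX = M w1
         | M wYY = M wXX]) /\
    (\rank (moment_matrix beta) = 6%N ->
       [\/ M wYY = M w1 - M wXX,
           M wYY = M w1 + M wXX,
           M wXY + M wYX = 0
         | M wYY = M w1]).
Proof.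
case: beta_nc => _ nc; case: nc_measure => mu [_ [[rep _ _] _]].
have [i0 nAB] := nc_atom rep nc; have rV := vanishes_relspace nAB.
have col phi q : pull (vanishes mu) phi q ->
    let M := mcol (transform phi beta) in
    q1 q *: M w1 + qX q *: M wX + qY q *: M wY + qXX q *: M wXX
    + qXY q *: (M wXY + M wYX) + qYY q *: M wYY = 0.
  move=> Vq; have Vq' : vanishes (act_measure phi mu) q.
    by move=> i; rewrite -[RHS](Vq i) -qeval_sub.
  exact: (vanishes_columns rep Vq').
case: rank56 => rk.
  have [phi Va H] := rank5_normal rV (rank5_pencil rep nc rk).
  exists phi => M; rewrite rk; split => // _; split.
    by have := col _ _ Va; rewrite /= -/M !scale0r scale1r !add0r addr0.
  case: H => /col; rewrite /= -/M => /colP E; clearbody M.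
  - by apply: Or41; apply/colP=> i; have := E i; rewrite !mxE; lra.
  - by apply: Or42; apply/colP=> i; have := E i; rewrite !mxE; lra.
  - by apply: Or43; apply/colP=> i; have := E i; rewrite !mxE; lra.
  - by apply: Or44; apply/colP=> i; have := E i; rewrite !mxE; lra.
have [q Vq q0] := rank6_quad rep nc rk.
have [phi H] := rank6_normal rV Vq q0.
exists phi => M; rewrite rk; split => // _.
case: H => /col; rewrite /= -/M => /colP E; clearbody M.
- by apply: Or41; apply/colP=> i; have := E i; rewrite !mxE; lra.
- by apply: Or42; apply/colP=> i; have := E i; rewrite !mxE; lra.
- by apply: Or43; apply/colP=> i; have := E i; rewrite !mxE; lra.
- by apply: Or44; apply/colP=> i; have := E i; rewrite !mxE; lra.
Qed.
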